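(* $\mathcal{MR}\!\left(\frac{I_5}{5},\frac{I_5}{5}\right)=7=\lfloor\sqrt{5^2+5^2-1}\rfloor$.
   Context: $\mathbb{M}_n$ is the algebra of complex $n\times n$ matrices with identity $I_n$. A linear map $\Phi:\mathbb{M}_{d_1}\to\mathbb{M}_{d_2}$ is completely positive (CP) if and only if $\Phi(X)=\sum_{j=1}^r V_j^*XV_j$ for some complex $d_1\times d_2$ matrices $V_j$; the smallest possible $r$ is the Choi-rank $CR(\Phi)$. $\Phi^*:\mathbb{M}_{d_2}\to\mathbb{M}_{d_1}$ is the dual map defined by $\mathrm{tr}(\Phi(X)^*Y)=\mathrm{tr}(X^*\Phi^*(Y))$. For $A_1\in\mathbb{M}_{d_1}$, $A_2\in\mathbb{M}_{d_2}$, let $\mathcal{CP}[\mathbb{M}_{d_1},\mathbb{M}_{d_2};A_1,A_2]$ be the convex set of all CP maps $\Phi:\mathbb{M}_{d_1}\to\mathbb{M}_{d_2}$ with $\Phi(I_{d_1})=A_2$ and $\Phi^*(I_{d_2})=A_1$, and let $\mathcal{MR}(A_1,A_2)=\sup\{CR(\Phi):\Phi\text{ is an extreme point of }\mathcal{CP}[\mathbb{M}_{d_1},\mathbb{M}_{d_2};A_1,A_2]\}$. $\lfloor a\rfloor$ is the largest integer not exceeding $a$. Here $d_1=d_2=5$. *)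

(* Defs.v *)
From HB Require Import structures.
From mathcomp Require Import all_boot all_order all_algebra.
From mathcomp Require Import all_classical all_reals all_analysis.
From mathcomp Require Import complex.

Set Implicit Arguments.
Unset Strict Implicit.
Unset Printing Implicit Defensive.

Import Order.TTheory GRing.Theory Num.Theory.

Local Open Scope classical_set_scope.
Local Open Scope ring_scope.
Local Open Scope sesquilinear_scope.

Section ExtremePoint.
Variables (R : realType) (E : lmodType R[i]).

(* Convex combinations have real weights, embedded in the complex scalars. *)
Definition extreme_point (K : set E) (x : E) : Prop :=
  K x /\ forall (t : R) (y z : E), 0 < t < 1 -> K y -> K z ->
    x = (t%:C)%C *: y + ((1 - t)%:C)%C *: z -> y = x /\ z = x.

End ExtremePoint.

Section CompletelyPositive.
Variables (R : realType) (d1 d2 : nat).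
Local Notation C := R[i].
Local Notation maps := 'Hom('M[C]_d1, 'M[C]_d2).

Definition kraus (Phi : maps) (r : nat) : Prop :=
  exists V : 'I_r -> 'M[C]_(d1, d2),
    forall X : 'M[C]_d1, Phi X = \sum_(j < r) (V j)^t* *m X *m V j.

Definition completely_positive (Phi : maps) : Prop := exists r, kraus Phi r.

(* The least length of a Kraus decomposition; the default 0 is only reached
   when Phi is not completely positive (see choi_rankP). *)
Definition choi_rank (Phi : maps) : nat :=
  xget 0%N [set r | kraus Phi r /\ forall s, kraus Phi s -> (r <= s)%N].

Definition is_dual_map (Phi : maps) (Psi : 'Hom('M[C]_d2, 'M[C]_d1)) : Prop :=
  forall (X : 'M[C]_d1) (Y : 'M[C]_d2),
    \tr ((Phi X)^t* *m Y) = \tr (X^t* *m Psi Y).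

(* The default 0 is never reached: see dual_mapP and dual_map_unique. *)
Definition dual_map (Phi : maps) : 'Hom('M[C]_d2, 'M[C]_d1) :=
  xget 0 [set Psi | is_dual_map Phi Psi].

Definition CPset (A1 : 'M[C]_d1) (A2 : 'M[C]_d2) : set maps :=
  [set Phi | [/\ completely_positive Phi, Phi 1%:M = A2
               & dual_map Phi 1%:M = A1]].

(* Taken in the extended reals, so that no boundedness or nonemptiness of the
   set of ranks is presupposed. *)
Definition MR (A1 : 'M[C]_d1) (A2 : 'M[C]_d2) : \bar R :=
  ereal_sup [set ((choi_rank Phi)%:R%:E : \bar R)
            | Phi in extreme_point (CPset A1 A2)].

Lemma choi_rankP (Phi : maps) : completely_positive Phi ->
  kraus Phi (choi_rank Phi) /\
  forall s, kraus Phi s -> (choi_rank Phi <= s)%N.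
Proof.
move=> [r0 Hr0]; apply: (@xgetPex _ 0%N
  [set r | kraus Phi r /\ forall s, kraus Phi s -> (r <= s)%N]).
have ex : exists r, `[< kraus Phi r >] by exists r0; exact/asboolP.
have [r /asboolP Hr min] := ex_minnP ex.
by exists r; split=> // s Hs; apply: min; exact/asboolP.
Qed.

Lemma tr_delta_adj (i j : 'I_d1) (Z : 'M[C]_d1) :
  \tr ((delta_mx i j)^t* *m Z) = Z i j.
Proof.
rewrite trmx_delta map_delta_mx /mxtrace (bigD1 j) //= big1 ?addr0.
  rewrite mxE (bigD1 i) //= big1 ?addr0 => [|k /negPf ki].
    by rewrite mxE !eqxx mul1r.
  by rewrite mxE ki andbF mul0r.
by move=> k /negPf kj; rewrite mxE big1 // => l _; rewrite mxE kj mul0r.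
Qed.

Lemma dual_map_unique (Phi : maps) Psi1 Psi2 :
  is_dual_map Phi Psi1 -> is_dual_map Phi Psi2 -> Psi1 = Psi2.
Proof.
move=> H1 H2; apply/lfunP => Y; apply/matrixP => i j.
by rewrite -[LHS]tr_delta_adj -[RHS]tr_delta_adj -H1 -H2.
Qed.

Lemma dual_mapP (Phi : maps) : is_dual_map Phi (dual_map Phi).
Proof.
apply: (@xgetPex _ 0 [set Psi | is_dual_map Phi Psi]).
pose f Y : 'M[C]_d1 := \matrix_(i, j) \tr ((Phi (delta_mx i j))^t* *m Y).
have fL : linear f.
  by move=> a u v; apply/matrixP => i j; rewrite !mxE mulmxDr mxtraceD
    -scalemxAr mxtraceZ.
pose fl := GRing.isLinear.Build C _ _ _ f fL.
pose F : {linear _ -> _} := HB.pack f fl.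
exists (linfun F) => X Y; rewrite lfunE /=.
rewrite [X in Phi X]matrix_sum_delta linear_sum /=.
rewrite raddf_sum /= map_mx_sum mulmx_suml raddf_sum /=.
have trE (A B : 'M[C]_d1) :
    \tr (A^t* *m B) = \sum_i \sum_j (A i j)^* * B i j.
  rewrite /mxtrace exchange_big /=; apply: eq_bigr => j _; rewrite mxE.
  by apply: eq_bigr => i _; rewrite !mxE.
rewrite trE; apply: eq_bigr => i _.
rewrite linear_sum raddf_sum /= map_mx_sum mulmx_suml raddf_sum /=.
apply: eq_bigr => j _.
by rewrite linearZ /= linearZ /= map_mxZ -scalemxAl mxtraceZ mxE.
Qed.

End CompletelyPositive.

(* Main.v *)
From HB Require Import structures.
Require Import Defs.
From mathcomp Require Import all_boot all_order all_algebra.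
From mathcomp Require Import all_classical all_reals all_analysis.
From mathcomp Require Import complex zify lra.

(* Write A' for the adjoint of A. For Hermitian H let Phi_H be the map X |->
   sum_ij H_ij V_i' X V_j, so that Phi_I is the map with Kraus operators V_1,
   ..., V_r.

   Upper bound: the r^2 pairs (V_i' V_j, V_j V_i') lie in the space of pairs
   of matrices of equal trace, of dimension d1^2 + d2^2 - 1. If r^2 is
   larger, some Hermitian H <> 0 satisfies Phi_H(1) = 0 and Phi_H'(1) = 0 for
   the dual map. Scale H so that its spectrum lies in [-1, 1] and contains
   -1. Then Phi_I is the midpoint of Phi_(I + H) and Phi_(I - H), and
   extremality forces Phi_I = Phi_(I + H), which has r - 1 Kraus operators
   because I + H is singular.

   Lower bound: if these pairs are linearly independent, Phi_I is extreme of
   Choi rank r, because a map dominated by Phi_I has its Kraus operators in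
   the span of the V_j. For d1 = d2 = 5 and r = 7, where r^2 = d1^2 + d2^2 -
   1, such a family is given explicitly, over the Gaussian integers up to a
   factor 1/5. Real matrices would not do: the 21 antisymmetric combinations
   would have to be independent in a space of dimension 20. *)

Set Implicit Arguments.
Unset Strict Implicit.
Unset Printing Implicit Defensive.

Import Order.TTheory GRing.Theory Num.Theory.

Local Open Scope ring_scope.
Local Open Scope sesquilinear_scope.

(** * Adjoints, the trace pairing and spans *)

Section Adjoint.
Variable C : numClosedFieldType.

Lemma adjmxM m n p (A : 'M[C]_(m, n)) (B : 'M[C]_(n, p)) :
  (A *m B)^t* = B^t* *m A^t*.
Proof. by rewrite trmx_mul map_mxM. Qed.

Lemma adjmxZ m n a (A : 'M[C]_(m, n)) : (a *: A)^t* = a^* *: A^t*.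
Proof. by rewrite linearZ map_mxZ. Qed.

Lemma adjmx_sum m n I (s : seq I) (P : pred I) (F : I -> 'M[C]_(m, n)) :
  (\sum_(i <- s | P i) F i)^t* = \sum_(i <- s | P i) (F i)^t*.
Proof. by rewrite linear_sum map_mx_sum. Qed.

Lemma adjmx1 n : (1%:M : 'M[C]_n)^t* = 1%:M.
Proof. by rewrite trmx1 map_mx1. Qed.

Lemma tr_adj_mul m n (A B : 'M[C]_(m, n)) :
  \tr (A^t* *m B) = \sum_i \sum_j (A i j)^* * B i j.
Proof.
rewrite /mxtrace exchange_big /=; apply: eq_bigr => j _; rewrite mxE.
by apply: eq_bigr => i _; rewrite !mxE.
Qed.

Lemma mxvec_mul_tr m n (A B : 'M[C]_(m, n)) :
  (mxvec A *m (mxvec B)^T) 0 0 = \sum_i \sum_j A i j * B i j.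
Proof.
rewrite mxE (reindex _ (curry_mxvec_bij _ _)) /= pair_bigA /=.
by apply: eq_bigr => [[i j]] _ /=; rewrite mxE !mxvecE.
Qed.

(** A finite family spans its double orthogonal complement. The columns of the cokernel of [A]
    detect membership in its row space; conjugated and reshaped into matrices, they are test
    matrices Y orthogonal to every V_j. *)
Lemma span_of_ortho m n r (V : 'I_r -> 'M[C]_(m, n)) (W : 'M[C]_(m, n)) :
  (forall Y, (forall j, \tr ((V j)^t* *m Y) = 0) -> \tr (W^t* *m Y) = 0) ->
  exists b : 'I_r -> C, W = \sum_j b j *: V j.
Proof.
move=> ortho; pose A := \matrix_j mxvec (V j).
have dotE (U : 'M[C]_(m, n)) k :
    \tr (U^t* *m map_mx Num.conj (vec_mx (col k (cokermx A))^T)) =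
    ((mxvec U *m cokermx A) 0 k)^*.
  rewrite tr_adj_mul.
  have -> : (mxvec U *m cokermx A) 0 k =
      (mxvec U *m (mxvec (vec_mx (col k (cokermx A))^T))^T) 0 0.
    rewrite vec_mxK trmxK mxE [RHS]mxE; apply: eq_bigr => l _; congr (_ * _).
    by rewrite [RHS]mxE.
  rewrite mxvec_mul_tr rmorph_sum; apply: eq_bigr => i _.
  by rewrite rmorph_sum; apply: eq_bigr => j _; rewrite rmorphM [X in _ * X]mxE.
have /submxP [D WD] : (mxvec W <= A)%MS.
  rewrite submxE; apply/eqP/rowP => k; rewrite [RHS]mxE.
  apply: (can_inj (@conjCK C)); rewrite conjC0 -dotE; apply: ortho => j.
  rewrite dotE -[mxvec (V j)](rowK (fun j => mxvec (V j))) -row_mul.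
  by rewrite (mulmx_coker A) !mxE conjC0.
exists (D 0); apply: (can_inj mxvecK); rewrite WD mulmx_sum_row linear_sum.
by apply: eq_bigr => j _; rewrite rowK linearZ.
Qed.

End Adjoint.

(** * Forms attached to a family of Kraus operators *)

Section KrausForms.
Variables (C : numClosedFieldType) (d1 d2 r : nat).
Variable V : 'I_r -> 'M[C]_(d1, d2).
Implicit Types (H : 'M[C]_r) (X : 'M[C]_d1) (Y : 'M[C]_d2).

Definition kraus_form H X : 'M[C]_d2 :=
  \sum_i \sum_j H i j *: ((V i)^t* *m X *m V j).

Definition dual_form H Y : 'M[C]_d1 :=
  \sum_i \sum_j H i j *: (V j *m Y *m (V i)^t*).

Lemma kraus_formD a H K X :
  kraus_form (a *: H + K) X = a *: kraus_form H X + kraus_form K X.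
Proof.
rewrite scaler_sumr -big_split; apply: eq_bigr => i _.
rewrite scaler_sumr -big_split; apply: eq_bigr => j _ /=.
by rewrite !mxE scalerDl scalerA.
Qed.

Lemma dual_formD a H K Y :
  dual_form (a *: H + K) Y = a *: dual_form H Y + dual_form K Y.
Proof.
rewrite scaler_sumr -big_split; apply: eq_bigr => i _.
rewrite scaler_sumr -big_split; apply: eq_bigr => j _ /=.
by rewrite !mxE scalerDl scalerA.
Qed.

Lemma kraus_formZ a H X : kraus_form (a *: H) X = a *: kraus_form H X.
Proof.
rewrite scaler_sumr; apply: eq_bigr => i _; rewrite scaler_sumr.
by apply: eq_bigr => j _; rewrite mxE scalerA.
Qed.

Lemma dual_formZ a H Y : dual_form (a *: H) Y = a *: dual_form H Y.
Proof.
rewrite scaler_sumr; apply: eq_bigr => i _; rewrite scaler_sumr.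
by apply: eq_bigr => j _; rewrite mxE scalerA.
Qed.

Lemma kraus_form_linear H : linear (kraus_form H).
Proof.
move=> a X X'; rewrite scaler_sumr -big_split; apply: eq_bigr => i _.
rewrite scaler_sumr -big_split; apply: eq_bigr => j _ /=.
rewrite mulmxDr mulmxDl scalerDr -scalemxAr -scalemxAl.
by rewrite !scalerA mulrC.
Qed.

Lemma kraus_form_adj H X : (kraus_form H X)^t* = kraus_form (H^t*) (X^t*).
Proof.
rewrite /kraus_form exchange_big /= adjmx_sum; apply: eq_bigr => i _.
rewrite adjmx_sum; apply: eq_bigr => j _.
by rewrite adjmxZ !adjmxM trmxCK !mxE mulmxA.
Qed.

Lemma dual_form_adj H Y : (dual_form H Y)^t* = dual_form (H^t*) (Y^t*).
Proof.
rewrite /dual_form exchange_big /= adjmx_sum; apply: eq_bigr => i _.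
rewrite adjmx_sum; apply: eq_bigr => j _.
by rewrite adjmxZ !adjmxM trmxCK !mxE mulmxA.
Qed.

Lemma tr_kraus_form H X Y :
  \tr (kraus_form H X *m Y) = \tr (X *m dual_form H Y).
Proof.
rewrite mulmx_suml mulmx_sumr !linear_sum; apply: eq_bigr => i _ /=.
rewrite mulmx_suml mulmx_sumr !linear_sum; apply: eq_bigr => j _ /=.
rewrite -scalemxAl -scalemxAr !linearZ /=; congr (_ * _).
by rewrite -!mulmxA mxtrace_mulC !mulmxA.
Qed.

Lemma kraus_form1 X : kraus_form 1%:M X = \sum_j (V j)^t* *m X *m V j.
Proof.
apply: eq_bigr => i _; rewrite (bigD1 i) //= big1 ?addr0 => [|j /negPf ij].
  by rewrite mxE eqxx scale1r.
by rewrite mxE eq_sym ij scale0r.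
Qed.

Lemma dual_form1 Y : dual_form 1%:M Y = \sum_j V j *m Y *m (V j)^t*.
Proof.
apply: eq_bigr => i _; rewrite (bigD1 i) //= big1 ?addr0 => [|j /negPf ij].
  by rewrite mxE eqxx scale1r.
by rewrite mxE eq_sym ij scale0r.
Qed.

(** A factorization H = B' B yields s Kraus operators in the span of the V_j. The upper bound uses
    it to show that perturbed maps are completely positive, the lower bound to write a competing map
    as a form in the same V_j. *)
Lemma kraus_form_gram s (B : 'M[C]_(s, r)) X :
  kraus_form (B^t* *m B) X =
  \sum_k (\sum_j B k j *: V j)^t* *m X *m (\sum_j B k j *: V j).
Proof.
under [RHS]eq_bigr => k _.
  rewrite adjmx_sum !mulmx_suml.
  under eq_bigr => i _.
    rewrite mulmx_sumr.
    under eq_bigr => j _ do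
      rewrite adjmxZ -!scalemxAl -scalemxAr scalerA.
    over.
  over.
rewrite exchange_big; apply: eq_bigr => i _ /=.
rewrite exchange_big; apply: eq_bigr => j _ /=.
rewrite -scaler_suml mxE; congr (_ *: _).
by apply: eq_bigr => k _; rewrite !mxE.
Qed.

(* The traces of the two components agree, so one dimension is lost. *)
Lemma exists_null_form : (0 < d1)%N -> (d1 * d1 + d2 * d2 - 1 < r * r)%N ->
  exists H, [/\ H != 0, kraus_form H 1%:M = 0 & dual_form H 1%:M = 0].
Proof.
move=> d1_gt0 ltr.
pose f (u : 'rV[C]_(r * r)) :=
  row_mx (mxvec (dual_form (vec_mx u) 1%:M))
    (mxvec (kraus_form (vec_mx u) 1%:M)).
have fL : linear f.
  move=> a u v; rewrite /f scale_row_mx add_row_mx linearP dual_formD.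
  by rewrite kraus_formD !linearP.
pose fl := GRing.isLinear.Build C _ _ _ f fL.
pose F : {linear _ -> _} := HB.pack f fl.
(* As a column, [w] is the functional (A, B) -> tr A - tr B. It kills the image of [F], and it is
   nonzero because [d1] is positive. *)
pose w : 'cV[C]_(d1 * d1 + d2 * d2) :=
  col_mx (mxvec 1%:M)^T (- (mxvec 1%:M)^T).
have tr_dot n (A : 'M[C]_n) : mxvec A *m (mxvec 1%:M)^T = (\tr A)%:M.
  apply/rowP => i; rewrite ord1 mxvec_mul_tr [RHS]mxE mulr1n.
  apply: eq_bigr => k _; rewrite (bigD1 k) //= big1 ?addr0 => [|j /negPf jk].
    by rewrite mxE eqxx mulr1.
  by rewrite mxE eq_sym jk mulr0.
have Lw : lin1_mx F *m w = 0.
  apply/row_matrixP => k; rewrite row_mul row0 rowE mul_rV_lin1 /= /f.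
  rewrite mul_row_col mulmxN !tr_dot -[dual_form _ _]mul1mx -tr_kraus_form.
  by rewrite mulmx1 subrr.
have w_neq0 : w != 0.
  apply/eqP => /(congr1 usubmx); rewrite col_mxKu linear0 => /(congr1 trmx).
  rewrite trmxK trmx0 => /(congr1 vec_mx); rewrite mxvecK linear0.
  move=> /matrixP /(_ (Ordinal d1_gt0) (Ordinal d1_gt0)) /eqP.
  by rewrite !mxE eqxx oner_eq0.
have rkw : (0 < \rank w)%N by rewrite lt0n mxrank_eq0.
have rkL : (\rank (lin1_mx F) < r * r)%N.
  by move: (mulmx0_rank_max Lw) rkw ltr; lia.
have : kermx (lin1_mx F) != 0.
  by rewrite -mxrank_eq0 mxrank_ker -lt0n subn_gt0.
case/rowV0Pn => u /sub_kermxP; rewrite mul_rV_lin1 /= /f => fu0 u_neq0.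
exists (vec_mx u); split.
- by apply: contra u_neq0 => /eqP/(congr1 mxvec); rewrite vec_mxK linear0 => ->.
- apply: (can_inj mxvecK); rewrite linear0.
  by rewrite -[LHS](row_mxKr (mxvec (dual_form (vec_mx u) 1%:M))) fu0 linear0.
- apply: (can_inj mxvecK); rewrite linear0.
  rewrite -[LHS](row_mxKl _ (mxvec (kraus_form (vec_mx u) 1%:M))).
  by rewrite fu0 linear0.
Qed.

(** Null forms are stable under adjoints because the identity is self-adjoint. So H + H' works
    unless it is zero; in that case H is skew-Hermitian and ['i *: H] works. *)
Lemma exists_hermitian_null_form :
    (0 < d1)%N -> (d1 * d1 + d2 * d2 - 1 < r * r)%N ->
  exists H, [/\ H != 0, H^t* = H, kraus_form H 1%:M = 0 & dual_form H 1%:M = 0].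
Proof.
move=> d1_gt0 /(exists_null_form d1_gt0) [H [H0 kH dH]].
have kHs : kraus_form (H^t*) 1%:M = 0.
  by rewrite -[1%:M]adjmx1 -kraus_form_adj kH trmx0 map_mx0.
have dHs : dual_form (H^t*) 1%:M = 0.
  by rewrite -[1%:M]adjmx1 -dual_form_adj dH trmx0 map_mx0.
have adjD (A B : 'M[C]_r) : (A + B)^t* = A^t* + B^t*.
  by rewrite linearD map_mxD.
have [sum0|] := eqVneq (H + H^t*) 0; last first.
  exists (1 *: H + H^t*); split; rewrite ?scale1r //.
  - by rewrite adjD trmxCK addrC.
  - by rewrite -[H in H + _]scale1r kraus_formD kH kHs scaler0 addr0.
  - by rewrite -[H in H + _]scale1r dual_formD dH dHs scaler0 addr0.
exists ('i *: H); split.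
- by rewrite scaler_eq0 negb_or neq0Ci.
- rewrite adjmxZ conjCi -[H in RHS](addrK (H^t*)) sum0 sub0r.
  by rewrite scaleNr scalerN.
- by rewrite kraus_formZ kH scaler0.
- by rewrite dual_formZ dH scaler0.
Qed.

End KrausForms.

(** * Extremality from independence *)

Section ExtremeMaps.
Variables (R : realType) (d1 d2 : nat).
Local Notation C := R[i].
Local Notation maps := 'Hom('M[C]_d1, 'M[C]_d2).
Implicit Types (Phi Psi : maps).

Lemma kraus_formP Phi r (V : 'I_r -> 'M[C]_(d1, d2)) :
  (forall X, Phi X = \sum_(j < r) (V j)^t* *m X *m V j) ->
  forall X, Phi X = kraus_form V 1%:M X.
Proof. by move=> PhiE X; rewrite kraus_form1. Qed.

Lemma dual_map_form Phi r (V : 'I_r -> 'M[C]_(d1, d2)) H :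
  (forall X, Phi X = kraus_form V H X) ->
  forall Y, dual_map Phi Y = dual_form V (H^t*) Y.
Proof.
move=> PhiE Y; apply/matrixP => i j.
rewrite -[LHS]tr_delta_adj -[RHS]tr_delta_adj -(dual_mapP Phi) PhiE.
by rewrite kraus_form_adj tr_kraus_form.
Qed.

Lemma kraus_gram Phi r (V : 'I_r -> 'M[C]_(d1, d2)) s (B : 'M[C]_(s, r)) :
  (forall X, Phi X = kraus_form V (B^t* *m B) X) -> kraus Phi s.
Proof.
move=> PhiE; exists (fun k => \sum_j B k j *: V j) => X.
by rewrite PhiE kraus_form_gram.
Qed.


(* The quadratic form of the Choi matrix of Phi, in the variable conj Y. *)
Definition choi_form Phi (Y : 'M[C]_(d1, d2)) : C :=
  \sum_a \sum_b \sum_c \sum_e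
    Y a b * (Y c e)^* * Phi (delta_mx a c) b e.

(** The left side does not mention V, so the zero set of the form, the orthogonal complement of the
    V_j, is the same for every Kraus decomposition of [Phi]. *)
Lemma choi_form_kraus Phi r (V : 'I_r -> 'M[C]_(d1, d2)) Y :
  (forall X, Phi X = \sum_(j < r) (V j)^t* *m X *m V j) ->
  choi_form Phi Y = \sum_j `|\tr ((V j)^t* *m Y)| ^+ 2.
Proof.
move=> PhiE; rewrite /choi_form.
have entry a c b e : Phi (delta_mx a c) b e =
    \sum_j (V j a b)^* * V j c e.
  rewrite PhiE summxE; apply: eq_bigr => j _.
  (* Splitting the matrix unit into a column times a row reduces the entry to a product of two
     entries of [V j]. *)
  rewrite -(mul_delta_mx (0 : 'I_1)) mulmxA -mulmxA -colE -rowE mxE big_ord1.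
  by rewrite !mxE.
under [RHS]eq_bigr => j _.
  rewrite normCK tr_adj_mul rmorph_sum mulr_suml.
  under eq_bigr => a _.
    rewrite mulr_suml.
    under eq_bigr => b _.
      rewrite mulr_sumr.
      under eq_bigr => c _.
        rewrite rmorph_sum mulr_sumr.
        over.
      over.
    over.
  over.
rewrite [RHS]exchange_big; apply: eq_bigr => a _ /=.
rewrite [RHS]exchange_big; apply: eq_bigr => b _ /=.
rewrite [RHS]exchange_big; apply: eq_bigr => c _ /=.
rewrite [RHS]exchange_big; apply: eq_bigr => e _ /=.
rewrite entry mulr_sumr; apply: eq_bigr => j _.
rewrite rmorphM /= conjCK mulrACA; congr (_ * _); exact: mulrC.
Qed.

Lemma choi_form_ge0 Phi r Y : kraus Phi r -> 0 <= choi_form Phi Y.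
Proof.
move=> [V PhiE]; rewrite (choi_form_kraus _ PhiE).
by apply: sumr_ge0 => j _; rewrite exprn_ge0.
Qed.

Lemma choi_formD a b Phi Psi Y :
  choi_form (a *: Phi + b *: Psi) Y = a * choi_form Phi Y + b * choi_form Psi Y.
Proof.
rewrite !mulr_sumr -big_split; apply: eq_bigr => i _ /=.
rewrite !mulr_sumr -big_split; apply: eq_bigr => j _ /=.
rewrite !mulr_sumr -big_split; apply: eq_bigr => k _ /=.
rewrite !mulr_sumr -big_split; apply: eq_bigr => l _ /=.
by rewrite lfunE /= !lfunE /= !mxE mulrDr; congr (_ + _); rewrite mulrCA.
Qed.

(** A Y orthogonal to all V_j is a zero of the form of [Phi], hence of that of [Psi], a sum of
    squares; so Y is orthogonal to each W_k, and [span_of_ortho] applies. *)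
Lemma kraus_span Phi Psi r s
    (V : 'I_r -> 'M[C]_(d1, d2)) (W : 'I_s -> 'M[C]_(d1, d2)) :
  (forall X, Phi X = \sum_(j < r) (V j)^t* *m X *m V j) ->
  (forall X, Psi X = \sum_(j < s) (W j)^t* *m X *m W j) ->
  (forall Y, choi_form Phi Y = 0 -> choi_form Psi Y = 0) ->
  exists B : 'M[C]_(s, r), forall k, W k = \sum_j B k j *: V j.
Proof.
move=> PhiE PsiE dom.
suff /choice [b bE] : forall k, exists b : 'I_r -> C, W k = \sum_j b j *: V j.
  exists (\matrix_(k, j) b k j) => k; rewrite bE.
  by apply: eq_bigr => j _; rewrite mxE.
move=> k; apply: span_of_ortho => Y VY0.
have : choi_form Psi Y = 0.
  apply: dom; rewrite (choi_form_kraus _ PhiE) big1 // => j _.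
  by rewrite VY0 normr0 expr0n.
rewrite (choi_form_kraus _ PsiE) => /eqP; rewrite psumr_eq0; last first.
  by move=> j _; rewrite exprn_ge0.
by move=> /allP /(_ k (mem_index_enum k)); rewrite expf_eq0 normr_eq0 => /eqP.
Qed.

(** Linear independence over the complex numbers of the r^2 pairs (V_i' V_j, V_j V_i'), the
    coefficients being arranged as a matrix. *)
Definition independent_products r (V : 'I_r -> 'M[C]_(d1, d2)) : Prop :=
  forall H : 'M[C]_r,
    kraus_form V H 1%:M = 0 -> dual_form V H 1%:M = 0 -> H = 0.

Lemma dual_kraus Phi r (V : 'I_r -> 'M[C]_(d1, d2)) :
  (forall X, Phi X = \sum_(j < r) (V j)^t* *m X *m V j) ->
  forall Y, dual_map Phi Y = \sum_(j < r) V j *m Y *m (V j)^t*.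
Proof.
move=> /kraus_formP PhiE Y; rewrite (dual_map_form PhiE) adjmx1.
exact: dual_form1.
Qed.

(** By [kraus_span], [Psi] is the form of some B' B. As [Phi] and [Psi] have the same marginals, B'
    B - 1 is a null form, and independence gives B' B = 1. *)
Lemma eq_of_summand A1 A2 Phi Psi r (V : 'I_r -> 'M[C]_(d1, d2)) :
  (forall X, Phi X = \sum_(j < r) (V j)^t* *m X *m V j) ->
  independent_products V -> CPset A1 A2 Phi -> CPset A1 A2 Psi ->
  (forall Y, choi_form Phi Y = 0 -> choi_form Psi Y = 0) ->
  Psi = Phi.
Proof.
move=> PhiE indep [_ Phi1 Phid1] [[s [W PsiE]] Psi1 Psid1] dom.
have [B WE] := kraus_span PhiE PsiE dom.
have PsiB X : Psi X = kraus_form V (B^t* *m B) X.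
  by rewrite PsiE kraus_form_gram; apply: eq_bigr => k _; rewrite -WE.
have gramK : (B^t* *m B)^t* = B^t* *m B by rewrite adjmxM trmxCK.
suff H0 : -1 *: 1%:M + B^t* *m B = 0.
  move/eqP: H0; rewrite scaleN1r addrC subr_eq0 => /eqP H0.
  by apply/lfunP => X; rewrite PsiB H0 -(kraus_formP PhiE).
apply: indep.
- by rewrite kraus_formD -PsiB -(kraus_formP PhiE) Phi1 Psi1 scaleN1r addNr.
- have PhiD : dual_form V 1%:M 1%:M = A1.
    by rewrite dual_form1 -(dual_kraus PhiE); exact: Phid1.
  have PsiD : dual_form V (B^t* *m B) 1%:M = A1.
    by rewrite -gramK -(dual_map_form PsiB); exact: Psid1.
  by rewrite dual_formD PhiD PsiD scaleN1r addNr.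
Qed.

(** Choi forms of completely positive maps are nonnegative, so a zero of the form of a convex
    combination with positive weights is a zero of both summands; [eq_of_summand] then identifies
    each summand with [Phi]. *)
Lemma extreme_of_independent A1 A2 Phi r (V : 'I_r -> 'M[C]_(d1, d2)) :
  (forall X, Phi X = \sum_(j < r) (V j)^t* *m X *m V j) ->
  independent_products V -> CPset A1 A2 Phi ->
  extreme_point (CPset A1 A2) Phi.
Proof.
move=> PhiE indep KPhi; split=> // t y z /andP[t0 t1] Ky Kz Phi_yz.
have [[sy kry] _ _] := Ky; have [[sz krz] _ _] := Kz.
have tC : 0 < (t%:C)%C :> C by rewrite ltcR.
have t1C : 0 < ((1 - t)%:C)%C :> C by rewrite ltcR subr_gt0.
have split0 Y : choi_form Phi Y = 0 -> choi_form y Y = 0 /\ choi_form z Y = 0.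
  rewrite Phi_yz choi_formD => /eqP.
  have y0 := choi_form_ge0 Y kry; have z0 := choi_form_ge0 Y krz.
  rewrite paddr_eq0 ?mulr_ge0 ?(ltW tC) ?(ltW t1C) //.
  by rewrite !mulf_eq0 (gt_eqF tC) (gt_eqF t1C) => /andP[/eqP-> /eqP->].
by split; apply: (eq_of_summand PhiE indep KPhi) => // Y /split0[].
Qed.

(** A shorter family W would span all the V_k, forcing a linear relation among them, and such a
    relation yields a nonzero null form. *)
Lemma choi_rank_independent Phi r (V : 'I_r -> 'M[C]_(d1, d2)) :
  (forall X, Phi X = \sum_(j < r) (V j)^t* *m X *m V j) ->
  independent_products V -> choi_rank Phi = r.
Proof.
move=> PhiE indep; have kr : kraus Phi r by exists V.
have [[W PhiW] min] := choi_rankP (ex_intro _ _ kr).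
apply/eqP; rewrite eqn_leq min //=; set s := choi_rank Phi in W PhiW *.
have [B VE] := kraus_span PhiW PhiE (fun Y => id).
rewrite leqNgt; apply/negP => lt_sr.
have : kermx B != 0.
  rewrite -mxrank_eq0 mxrank_ker -lt0n subn_gt0.
  by apply: leq_ltn_trans lt_sr; apply: rank_leq_col.
case/rowV0Pn => u /sub_kermxP uB /eqP; apply.
have uV : \sum_i u 0 i *: V i = 0.
  under eq_bigr => i _ do rewrite VE scaler_sumr.
  rewrite exchange_big big1 // => k _ /=.
  under eq_bigr => i _ do rewrite scalerA.
  rewrite -scaler_suml.
  by move/rowP: uB => /(_ k); rewrite !mxE => ->; rewrite scale0r.
(* The only nonzero row allowed is row i, equal to [u]. Both forms then contain the factor
   [\sum_l u 0 l *: V l], which is zero. *)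
apply/rowP => i; have : \matrix_(k, l) ((k == i)%:R * u 0 l) = 0 :> 'M[C]_r.
  apply: indep; rewrite /kraus_form /dual_form big1 // => k _.
    under eq_bigr => l _ do rewrite mxE -scalerA scalemxAr.
    by rewrite -scaler_sumr -mulmx_sumr uV mulmx0 scaler0.
  under eq_bigr => l _ do rewrite mxE -scalerA mulmx1 scalemxAl.
  by rewrite -scaler_sumr -mulmx_suml uV mul0mx scaler0.
by move=> /matrixP /(_ i i); rewrite !mxE eqxx mul1r.
Qed.

End ExtremeMaps.

(** * The bound on the Choi rank of an extreme point *)

Section Upper.
Variable (R : realType).
Local Notation C := R[i].

Definition real_diag n (mu : 'I_n -> R) : 'M[C]_n :=
  diag_mx (\row_k ((mu k)%:C)%C).

Lemma conj_realC (x : R) : (x%:C)%C^* = (x%:C)%C.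
Proof. by apply/CrealP; apply/complex_realP; exists x. Qed.

Lemma real_diag_adj n (mu : 'I_n -> R) : (real_diag mu)^t* = real_diag mu.
Proof.
rewrite /real_diag tr_diag_mx map_diag_mx; congr diag_mx.
apply/rowP => k; rewrite !mxE; exact: conj_realC.
Qed.

Lemma real_diagD n a (mu nu : 'I_n -> R) :
  real_diag (fun k => mu k + a * nu k) =
  real_diag mu + (a%:C)%C *: real_diag nu.
Proof.
apply/matrixP => i j; rewrite !mxE.
case: (i == j); last by rewrite !mulr0n mulr0 addr0.
by rewrite !mulr1n rmorphD rmorphM.
Qed.

(** Spectral theorem, followed by division by minus an eigenvalue of largest modulus: that
    eigenvalue becomes -1 and the others stay in [-1, 1]. *)
Lemma hermitian_normal_form n (H : 'M[C]_n) : H^t* = H -> H != 0 ->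
  exists (a : C) (P : 'M[C]_n) (mu : 'I_n -> R) (k0 : 'I_n),
    [/\ P^t* *m P = 1%:M, a *: H = P^t* *m real_diag mu *m P,
        mu k0 = -1 & forall k, `|mu k| <= 1].
Proof.
move=> Hh H_neq0.
have Hherm : H \is hermsymmx.
  by apply/is_hermitianmxP; rewrite expr0 scale1r Hh.
have := Hherm => /hermitian_normalmx /orthomx_spectralP.
rewrite invmx_unitary ?spectral_unitarymx //.
have := hermitian_spectral_diag_real Hherm.
have := spectral_unitarymx H.
move: (spectral_diag H) (spectralmx H) => sp P Pu /mxOverP spR HE.
pose lam k := complex.Re (sp 0 k).
have spE : diag_mx sp = real_diag lam.
  by congr diag_mx; apply/rowP => k; rewrite mxE RRe_real.
have [k1 k1P] : exists k, lam k != 0.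
  apply/existsP; apply: contraR H_neq0 => /existsPn lam0.
  rewrite HE; suff -> : sp = 0 by rewrite linear0 mulmx0 mul0mx.
  apply/rowP => k; rewrite mxE -(RRe_real (spR 0 k)).
  by move: (lam0 k); rewrite negbK => /eqP; rewrite /lam => ->.
pose k0 := [arg max_(k > k1) `|lam k|]%O.
have kmax k : `|lam k| <= `|lam k0|.
  by rewrite /k0; case: arg_maxP => // i _ /(_ k); apply.
have lam0 : 0 < `|lam k0| by apply: lt_le_trans (kmax k1); rewrite normr_gt0.
exists ((- (lam k0)^-1)%:C)%C, P, (fun k => - (lam k0)^-1 * lam k), k0; split.
- by apply: mulmx1C; apply/unitarymxP.
- rewrite HE spE; set a := (_%:C)%C.
  have -> : real_diag (fun k => - (lam k0)^-1 * lam k) = a *: real_diag lam.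
    apply/matrixP => i j; rewrite !mxE.
    case: (i == j); last by rewrite !mulr0n mulr0.
    by rewrite !mulr1n rmorphM.
  by rewrite -scalemxAr -scalemxAl.
- by rewrite mulNr mulVf // -normr_gt0.
- move=> k; rewrite normrM normrN normfV mulrC ler_pdivrMr // mul1r.
  exact: kmax.
Qed.

(** This choice of Gram factor has a zero row wherever [nu] vanishes, which later removes one Kraus
    operator. *)
Lemma real_diag_gram n (P : 'M[C]_n) (nu : 'I_n -> R) : (forall k, 0 <= nu k) ->
  P^t* *m real_diag nu *m P =
  (real_diag (fun k => Num.sqrt (nu k)) *m P)^t*
    *m (real_diag (fun k => Num.sqrt (nu k)) *m P).
Proof.
move=> nu0; rewrite adjmxM real_diag_adj !mulmxA; congr (_ *m _).
rewrite -!mulmxA; congr (_ *m _).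
rewrite /real_diag mulmx_diag; congr diag_mx; apply/rowP => k.
by rewrite !mxE -rmorphM -expr2 sqr_sqrtr.
Qed.

Variables d1 d2 : nat.
Local Notation maps := 'Hom('M[C]_d1, 'M[C]_d2).
Implicit Types (Phi Psi : maps).

Lemma kraus_form_hom r (V : 'I_r -> 'M[C]_(d1, d2)) H :
  exists Psi : maps, forall X, Psi X = kraus_form V H X.
Proof.
pose fl := GRing.isLinear.Build C _ _ _ _ (kraus_form_linear V H).
pose F : {linear _ -> _} := HB.pack (kraus_form V H) fl.
by exists (linfun F) => X; rewrite lfunE.
Qed.

Lemma kraus_drop0 Phi r (W : 'I_r -> 'M[C]_(d1, d2)) k0 : W k0 = 0 ->
  (forall X, Phi X = \sum_(j < r) (W j)^t* *m X *m W j) -> kraus Phi r.-1.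
Proof.
case: r W k0 => [|r] W k0; first by case: k0.
move=> W0 PhiE; exists (fun j => W (lift k0 j)) => X.
by rewrite PhiE (bigD1_ord k0) //= W0 mulmx0 add0r.
Qed.

Lemma extreme_no_null_form A1 A2 Phi r (V : 'I_r -> 'M[C]_(d1, d2)) H :
  extreme_point (CPset A1 A2) Phi ->
  (forall X, Phi X = \sum_(j < r) (V j)^t* *m X *m V j) ->
  H^t* = H -> H != 0 -> kraus_form V H 1%:M = 0 -> dual_form V H 1%:M = 0 ->
  kraus Phi r.-1.
Proof.
move=> [KPhi ext] PhiE Hh H0 kH dH.
have [a [P [mu [k0 [PP aH mu0 mu1]]]]] := hermitian_normal_form Hh H0.
(* [D s] is 1 + s a H in the eigenbasis of H. It is positive semidefinite for |s| <= 1, and singular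
   at s = 1 because [mu k0] is -1. *)
pose D (s : R) := P^t* *m real_diag (fun k => 1 + s * mu k) *m P.
have DE s : D s = (((s%:C)%C * a) *: H + 1%:M).
  rewrite /D real_diagD mulmxDr mulmxDl -scalemxAr -scalemxAl -aH scalerA addrC.
  congr (_ + _); rewrite -[RHS]PP -[P^t* in RHS]mulmx1; congr (_ *m _ *m _).
  by apply/matrixP => i j; rewrite !mxE; case: (i == j).
pose B s := real_diag (fun k => Num.sqrt (1 + s * mu k)) *m P.
have DB s : `|s| <= 1 -> D s = (B s)^t* *m B s.
  move=> s1; apply: real_diag_gram => k.
  have : `|s * mu k| <= 1 by rewrite normrM mulr_ile1.
  by rewrite ler_norml => /andP[? _]; rewrite -lerBlDl sub0r.
have Dh s : `|s| <= 1 -> (D s)^t* = D s.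
  by move=> /DB ->; rewrite adjmxM trmxCK.
(* Adding a multiple of the null form [H] changes neither marginal. *)
have mem s Psi : `|s| <= 1 -> (forall X, Psi X = kraus_form V (D s) X) ->
    CPset A1 A2 Psi.
  move=> s1 PsiE; have [_ Phi1 Phid1] := KPhi; split.
  - by exists r; apply: (kraus_gram (B := B s)) => X; rewrite PsiE DB.
  - by rewrite PsiE DE kraus_formD kH scaler0 add0r -(kraus_formP PhiE).
  - rewrite (dual_map_form PsiE) Dh // DE dual_formD dH scaler0 add0r.
    by rewrite dual_form1 -(dual_kraus PhiE).
have n1 : `|1 : R| <= 1 by rewrite normr1.
have nN1 : `|-1 : R| <= 1 by rewrite normrN1.
have [y yE] := kraus_form_hom V (D 1).
have [z zE] := kraus_form_hom V (D (-1)).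
have [] := ext 2^-1 y z _ (mem _ _ n1 yE) (mem _ _ nN1 zE).
- by lra.
- apply/lfunP => X; rewrite lfunE /= !lfunE /= yE zE !DE !kraus_formD.
  have -> : 1 - 2^-1 = 2^-1 :> R by lra.
  rewrite -scalerDr addrACA -scalerDl -mulrDl -rmorphD subrr.
  rewrite mul0r scale0r add0r.
  rewrite scalerDr -scalerDl -rmorphD; have -> : 2^-1 + 2^-1 = 1 :> R by lra.
  by rewrite scale1r (kraus_formP PhiE).
move=> yPhi _; rewrite -yPhi.
apply: (kraus_drop0 (W := fun k => \sum_j B 1 k j *: V j) (k0 := k0)).
  (* Row [k0] of [B 1] carries the factor sqrt(1 + mu k0) = 0. *)
  rewrite big1 // => j _; rewrite /B mul_diag_mx mxE mxE mu0 mul1r subrr.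
  by rewrite sqrtr0 mul0r scale0r.
by move=> X; rewrite yE DB // kraus_form_gram.
Qed.

Lemma choi_rank_extreme_le A1 A2 Phi : (0 < d1)%N ->
  extreme_point (CPset A1 A2) Phi ->
  (choi_rank Phi * choi_rank Phi <= d1 * d1 + d2 * d2 - 1)%N.
Proof.
move=> d1_gt0 ext; have [[CPPhi _ _] _] := ext.
have [[V PhiE] min] := choi_rankP CPPhi.
rewrite leqNgt; apply/negP => /(exists_hermitian_null_form V d1_gt0).
move=> [H [H0 Hh kH dH]].
have := min _ (extreme_no_null_form ext PhiE Hh H0 kH dH).
(* At rank 0 the predecessor is again 0, so minimality gives no contradiction; there the nonzero [H]
   would have no entries. *)
have [|r_gt0] := posnP (choi_rank Phi); last by rewrite leqNgt prednK // leqnn.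
move=> r0; move: H H0 {Hh kH dH}; rewrite r0 => H /eqP[].
by apply/matrixP => - [].
Qed.

End Upper.

(** * Seven Kraus operators in dimension five *)

Notation gauss := (complex int).

(* Rows and columns are indexed by the points 0, ..., 4 of Z/6.  The matrices
   have degree 0, 1, 2, 3, 4, 5, 5: the entry (a, b) of a matrix of degree d
   vanishes unless b - a = d modulo 6.  So V_i' V_j and V_j V_i' are homogeneous
   of degree d_j - d_i, and in each degree there are as many pairs (i, j) as
   dimensions in the space of pairs of matrices of equal trace. *)
Definition gauss_kraus : seq (seq (seq gauss)) :=
  let o := Complex 0 0 in let e := Complex 1 0 in
  let p := Complex 1 1 in let m := Complex 1 (-1) in
  [::
      [:: [:: e; o; o; o; o];
          [:: o; o; o; o; o];
          [:: o; o; o; o; o];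
          [:: o; o; o; p; o];
          [:: o; o; o; o; e]];
      [:: [:: o; o; o; o; o];
          [:: o; o; e; o; o];
          [:: o; o; o; p; o];
          [:: o; o; o; o; o];
          [:: o; o; o; o; o]];
      [:: [:: o; o; m; o; o];
          [:: o; o; o; o; o];
          [:: o; o; o; o; e];
          [:: o; o; o; o; o];
          [:: o; o; o; o; o]];
      [:: [:: o; o; o; o; o];
          [:: o; o; o; o; e];
          [:: o; o; o; o; o];
          [:: e; o; o; o; o];
          [:: o; p; o; o; o]];
      [:: [:: o; o; o; o; p];
          [:: o; o; o; o; o];
          [:: o; o; o; o; o];
          [:: o; e; o; o; o];
          [:: o; o; e; o; o]];
      [:: [:: o; o; o; o; o];
          [:: e; o; o; o; o];
          [:: o; e; o; o; o];
          [:: o; o; o; o; o];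
          [:: o; o; o; e; o]];
      [:: [:: o; o; o; o; o];
          [:: p; o; o; o; o];
          [:: o; e; o; o; o];
          [:: o; o; e; o; o];
          [:: o; o; o; o; o]]].

(* A left inverse for the 49 pairs (V_i' V_j, V_j V_i'): item 7p + q is
   (D, L), where L lists the coefficients of a linear form on pairs of matrices
   (true: entry of the first component) equal to D on the pair (p, q) and to 0
   on the others. *)
Definition certificate : seq (int * seq (bool * nat * nat * gauss)) :=
  [::
   (5, [:: (true, 0, 0, Complex 4 0); (true, 1, 1, Complex (-2) 0);
     (true, 4, 4, Complex 4 0); (false, 0, 0, Complex (-3) 0);
     (false, 1, 1, Complex (-4) 0); (false, 2, 2, Complex 2 0)]);
   (2, [:: (true, 0, 1, Complex 2 (-2)); (true, 1, 2, Complex (-1) 0);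
     (true, 2, 3, Complex (-1) 0); (true, 3, 4, Complex 0 (-1));
     (false, 0, 1, Complex 0 1); (false, 2, 3, Complex 1 0)]);
   (5, [:: (true, 0, 2, Complex (-1) 3); (true, 1, 3, Complex (-4) 2);
     (true, 4, 0, Complex (-1) 3); (false, 0, 2, Complex (-3) (-1));
     (false, 1, 3, Complex 4 (-2)); (false, 2, 4, Complex 3 (-4));
     (false, 4, 0, Complex 3 1)]);
   (2, [:: (true, 3, 0, Complex 1 1)]);
   (2, [:: (false, 0, 4, Complex 1 (-1)); (false, 2, 0, Complex (-1) 1)]);
   (2, [:: (true, 2, 1, Complex (-1) (-1)); (false, 4, 3, Complex 1 1)]);
   (2, [:: (true, 1, 0, Complex 0 2); (true, 4, 3, Complex (-1) 1);
     (false, 1, 0, Complex 1 (-1))]);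
   (2, [:: (true, 1, 0, Complex 2 2); (true, 2, 1, Complex (-1) 0);
     (true, 3, 2, Complex (-1) 0); (true, 4, 3, Complex 0 1);
     (false, 1, 0, Complex 0 (-1)); (false, 3, 2, Complex 1 0)]);
   (5, [:: (true, 0, 0, Complex (-1) 0); (true, 1, 1, Complex (-2) 0);
     (true, 4, 4, Complex 4 0); (false, 0, 0, Complex (-3) 0);
     (false, 1, 1, Complex 1 0); (false, 2, 2, Complex 2 0)]);
   (2, [:: (true, 1, 2, Complex 1 0); (true, 3, 4, Complex 1 1);
     (false, 3, 4, Complex (-1) 0)]);
   (2, [:: (true, 2, 4, Complex 2 0); (false, 0, 2, Complex (-1) (-1));
     (false, 4, 0, Complex (-1) (-1))]);
   (2, [:: (true, 0, 3, Complex (-1) 1); (false, 4, 1, Complex 2 0)]);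
   (10, [:: (true, 0, 4, Complex 2 6); (true, 2, 0, Complex 2 6);
     (true, 3, 1, Complex 3 9); (false, 0, 4, Complex (-11) (-3));
     (false, 2, 0, Complex 11 3); (false, 3, 1, Complex (-8) (-14));
     (false, 4, 2, Complex 4 (-8))]);
   (1, [:: (true, 0, 4, Complex (-1) 0); (false, 0, 4, Complex 1 0);
     (false, 2, 0, Complex (-1) 0); (false, 3, 1, Complex 1 0)]);
   (5, [:: (true, 0, 4, Complex (-1) (-3)); (true, 2, 0, Complex (-1) (-3));
     (true, 3, 1, Complex (-4) (-2)); (false, 0, 4, Complex 3 (-1));
     (false, 2, 0, Complex (-3) 1); (false, 3, 1, Complex 4 2);
     (false, 4, 2, Complex 3 4)]);
   (2, [:: (true, 2, 1, Complex 1 0); (true, 4, 3, Complex 1 (-1));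
     (false, 4, 3, Complex (-1) 0)]);
   (5, [:: (true, 1, 1, Complex (-11) 0); (true, 2, 2, Complex (-4) 0);
     (true, 3, 3, Complex (-9) 0); (false, 0, 0, Complex 1 0);
     (false, 2, 2, Complex 11 0); (false, 3, 3, Complex 4 0);
     (false, 4, 4, Complex 9 0)]);
   (1, [:: (false, 1, 2, Complex 1 0)]);
   (2, [:: (false, 0, 2, Complex 1 (-1))]);
   (2, [:: (true, 3, 0, Complex 1 (-2)); (true, 4, 1, Complex 2 0);
     (false, 3, 0, Complex (-1) 1)]);
   (2, [:: (true, 3, 0, Complex (-1) 0); (false, 3, 0, Complex 1 (-1))]);
   (2, [:: (true, 0, 3, Complex 1 (-1))]);
   (2, [:: (true, 4, 2, Complex 2 0); (false, 0, 4, Complex (-1) 1);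
     (false, 2, 0, Complex (-1) 1)]);
   (1, [:: (false, 2, 1, Complex 1 0)]);
   (5, [:: (true, 0, 0, Complex 9 0); (true, 1, 1, Complex (-2) 0);
     (true, 2, 2, Complex 5 0); (true, 4, 4, Complex 14 0);
     (false, 0, 0, Complex (-13) 0); (false, 1, 1, Complex (-9) 0);
     (false, 2, 2, Complex 2 0); (false, 3, 3, Complex (-5) 0)]);
   (1, [:: (true, 0, 1, Complex 1 0)]);
   (5, [:: (true, 0, 2, Complex (-3) (-1)); (true, 1, 3, Complex (-2) 1);
     (true, 4, 0, Complex (-3) 4); (false, 0, 2, Complex (-4) 2);
     (false, 1, 3, Complex 7 (-1)); (false, 2, 4, Complex 4 (-2));
     (false, 4, 0, Complex 4 (-2))]);
   (10, [:: (true, 0, 2, Complex 4 (-2)); (true, 1, 3, Complex 1 (-3));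
     (true, 4, 0, Complex 4 (-12)); (false, 0, 2, Complex 7 (-11));
     (false, 1, 3, Complex (-6) 8); (false, 2, 4, Complex (-2) 6);
     (false, 4, 0, Complex (-7) 11)]);
   (2, [:: (false, 0, 2, Complex (-1) (-1)); (false, 4, 0, Complex 1 1)]);
   (2, [:: (true, 3, 0, Complex (-1) (-1)); (false, 1, 4, Complex 2 0)]);
   (2, [:: (false, 2, 0, Complex 1 1)]);
   (1, [:: (true, 1, 0, Complex 1 0)]);
   (5, [:: (true, 1, 1, Complex 14 0); (true, 2, 2, Complex 6 0);
     (true, 3, 3, Complex 11 0); (false, 0, 0, Complex 1 0);
     (false, 2, 2, Complex (-14) 0); (false, 3, 3, Complex (-6) 0);
     (false, 4, 4, Complex (-11) 0)]);
   (1, [:: (true, 0, 1, Complex (-1) 1); (true, 2, 3, Complex 1 0);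
     (true, 3, 4, Complex 0 1); (false, 0, 1, Complex 0 (-1))]);
   (1, [:: (true, 0, 1, Complex (-1) 1); (true, 1, 2, Complex 1 0)]);
   (2, [:: (true, 1, 2, Complex (-1) 1); (false, 3, 4, Complex 1 (-1))]);
   (10, [:: (true, 0, 2, Complex 2 (-6)); (true, 1, 3, Complex 3 (-9));
     (true, 4, 0, Complex 2 (-6)); (false, 0, 2, Complex 11 (-3));
     (false, 1, 3, Complex (-8) 14); (false, 2, 4, Complex 4 8);
     (false, 4, 0, Complex (-11) 3)]);
   (2, [:: (true, 0, 3, Complex 1 2); (true, 1, 4, Complex 2 0);
     (false, 0, 3, Complex (-1) (-1))]);
   (5, [:: (true, 0, 4, Complex (-3) (-4)); (true, 2, 0, Complex (-3) 1);
     (true, 3, 1, Complex (-2) (-1)); (false, 0, 4, Complex 4 2);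
     (false, 2, 0, Complex (-4) (-2)); (false, 3, 1, Complex 7 1);
     (false, 4, 2, Complex 4 2)]);
   (1, [:: (true, 1, 0, Complex (-1) (-1)); (true, 3, 2, Complex 1 0);
     (true, 4, 3, Complex 0 (-1)); (false, 1, 0, Complex 0 1)]);
   (5, [:: (true, 0, 0, Complex (-6) 0); (true, 1, 1, Complex 8 0);
     (true, 3, 3, Complex 5 0); (true, 4, 4, Complex (-16) 0);
     (false, 0, 0, Complex 12 0); (false, 1, 1, Complex 6 0);
     (false, 2, 2, Complex (-8) 0)]);
   (2, [:: (true, 1, 1, Complex (-2) 2); (true, 2, 2, Complex (-2) 1);
     (true, 3, 3, Complex (-2) 1); (true, 4, 4, Complex 1 (-1));
     (false, 1, 1, Complex 0 (-1)); (false, 2, 2, Complex 3 (-1));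
     (false, 3, 3, Complex 1 0); (false, 4, 4, Complex 1 (-1))]);
   (2, [:: (true, 0, 1, Complex 0 (-2)); (true, 3, 4, Complex (-1) (-1));
     (false, 0, 1, Complex 1 1)]);
   (1, [:: (true, 4, 0, Complex (-1) 0); (false, 0, 2, Complex (-1) 0);
     (false, 1, 3, Complex 1 0); (false, 4, 0, Complex 1 0)]);
   (2, [:: (true, 0, 3, Complex (-1) 0); (false, 0, 3, Complex 1 1)]);
   (10, [:: (true, 0, 4, Complex 4 12); (true, 2, 0, Complex 4 2);
     (true, 3, 1, Complex 1 3); (false, 0, 4, Complex (-7) (-11));
     (false, 2, 0, Complex 7 11); (false, 3, 1, Complex (-6) (-8));
     (false, 4, 2, Complex (-2) (-6))]);
   (1, [:: (true, 1, 0, Complex (-1) (-1)); (true, 2, 1, Complex 1 0)]);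
   (2, [:: (true, 1, 1, Complex (-2) (-2)); (true, 2, 2, Complex (-2) (-1));
     (true, 3, 3, Complex (-2) (-1)); (true, 4, 4, Complex 1 1);
     (false, 1, 1, Complex 0 1); (false, 2, 2, Complex 3 1);
     (false, 3, 3, Complex 1 0); (false, 4, 4, Complex 1 1)]);
   (5, [:: (true, 0, 0, Complex (-6) 0); (true, 1, 1, Complex 3 0);
     (true, 4, 4, Complex (-11) 0); (false, 0, 0, Complex 7 0);
     (false, 1, 1, Complex 6 0); (false, 2, 2, Complex (-3) 0);
     (false, 3, 3, Complex 5 0)])].

Definition gauss_entry (j a b : nat) : gauss :=
  nth 0 (nth [::] (nth [::] gauss_kraus j) a) b.

(* [true] for V_i' V_j, [false] for V_j V_i'. *)
Definition gauss_product (k : bool) (i j a b : nat) : gauss :=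
  foldr (fun c s =>
    (if k then mulc (conjc (gauss_entry i c a)) (gauss_entry j c b)
     else mulc (gauss_entry j a c) (conjc (gauss_entry i b c))) + s)
  0 (iota 0 5).

Definition certified_value (cert : seq (bool * nat * nat * gauss)) (i j : nat) :
    gauss :=
  foldr (fun t s => let: (k, a, b, z) := t in
    mulc z (gauss_product k i j a b) + s) 0 cert.

Definition certificate_at (p q : nat) := nth (0, [::]) certificate (7 * p + q).

Definition all_below n (P : pred nat) := all P (iota 0 n).

Lemma all_belowP n (P : pred nat) (i : 'I_n) : all_below n P -> P i.
Proof. by move=> /allP; apply; rewrite mem_iota add0n ltn_ord. Qed.

Definition in_range (t : bool * nat * nat * gauss) :=
  let: (_, a, b, _) := t in (a < 5)%N && (b < 5)%N.

(** Everything is decided by evaluation over the Gaussian integers. The range check lets each index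
    be read later as an element of ['I_5]. *)
Lemma certificate_correct :
  all_below 7 (fun p => all_below 7 (fun q =>
    let: (D, cert) := certificate_at p q in
    [&& D != 0, all in_range cert &
      all_below 7 (fun i => all_below 7 (fun j =>
      certified_value cert i j ==
        Complex (if (p == i) && (q == j) then D else 0) 0))])).
Proof. by vm_compute. Qed.

(** Both marginals are 5 I, which explains the factor 1/5: operators scaled by it have marginals
    5/25 I = I/5. *)
Lemma gauss_marginals :
  all_below 5 (fun a => all_below 5 (fun b =>
    all (fun k => foldr (fun j s => gauss_product k j j a b + s) 0 (iota 0 7)
      == Complex (if a == b then 5 else 0) 0) [:: true; false])).
Proof. by vm_compute. Qed.

(** * From Gaussian integers to complex matrices *)

Section Example.
Variable R : realType.
Local Notation C := R[i].

Definition of_gauss (z : gauss) : C :=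
  Complex ((complex.Re z)%:~R) ((complex.Im z)%:~R).

Lemma of_gaussD z w : of_gauss (z + w) = of_gauss z + of_gauss w.
Proof. by case: z w => [a b] [c d]; rewrite /of_gauss /= !intrD. Qed.

Lemma of_gaussM z w : of_gauss (mulc z w) = of_gauss z * of_gauss w.
Proof.
by case: z w => [a b] [c d]; rewrite /of_gauss /= intrB intrD !intrM.
Qed.

Lemma of_gauss_conj z : of_gauss (conjc z) = (of_gauss z)^*.
Proof. by case: z => [a b]; rewrite /of_gauss /= rmorphN. Qed.

Lemma of_gauss_sum n (f : nat -> gauss) :
  of_gauss (foldr (fun c s => f c + s) 0 (iota 0 n)) =
  \sum_(c < n) of_gauss (f c).
Proof.
rewrite -(big_mkord xpredT (fun c => of_gauss (f c))) /index_iota subn0.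
elim: (iota 0 n) => [|c s IHs] /=; first by rewrite big_nil.
by rewrite big_cons of_gaussD IHs.
Qed.

Definition kraus5 (j : 'I_7) : 'M[C]_5 :=
  \matrix_(a, b) of_gauss (gauss_entry j a b).

Lemma kraus5_adjl i j a b :
  ((kraus5 i)^t* *m kraus5 j) a b = of_gauss (gauss_product true i j a b).
Proof.
rewrite of_gauss_sum mxE; apply: eq_bigr => c _.
by rewrite !mxE of_gaussM of_gauss_conj.
Qed.

Lemma kraus5_adjr i j a b :
  (kraus5 j *m (kraus5 i)^t*) a b = of_gauss (gauss_product false i j a b).
Proof.
rewrite of_gauss_sum mxE; apply: eq_bigr => c _.
by rewrite !mxE of_gaussM of_gauss_conj.
Qed.

Lemma kraus_form_kraus5 H a b : kraus_form kraus5 H 1%:M a b =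
  \sum_i \sum_j H i j * of_gauss (gauss_product true i j a b).
Proof.
rewrite summxE; apply: eq_bigr => i _; rewrite summxE; apply: eq_bigr => j _.
by rewrite mxE mulmx1 kraus5_adjl.
Qed.

Lemma dual_form_kraus5 H a b : dual_form kraus5 H 1%:M a b =
  \sum_i \sum_j H i j * of_gauss (gauss_product false i j a b).
Proof.
rewrite summxE; apply: eq_bigr => i _; rewrite summxE; apply: eq_bigr => j _.
by rewrite mxE mulmx1 kraus5_adjr.
Qed.

(** The linear form certified for (p, q), applied to the two vanishing forms of [H], leaves
    [H p q * D%:~R = 0] with D nonzero. *)
Lemma kraus5_independent : independent_products kraus5.
Proof.
move=> H kH dH.
have prod0 k (a b : nat) : (a < 5)%N -> (b < 5)%N ->
    \sum_i \sum_j H i j * of_gauss (gauss_product k i j a b) = 0.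
  move=> a5 b5; case: k.
    by rewrite -(kraus_form_kraus5 H (Ordinal a5) (Ordinal b5)) kH mxE.
  by rewrite -(dual_form_kraus5 H (Ordinal a5) (Ordinal b5)) dH mxE.
have cert0 cert : all in_range cert ->
    \sum_i \sum_j H i j * of_gauss (certified_value cert i j) = 0.
  elim: cert => [_|[[[k a] b] z] cert IHc] /=.
    by rewrite big1 // => i _; rewrite big1 // => j _; rewrite mulr0.
  move=> /andP[/andP[a5 b5] /IHc {}IHc].
  under eq_bigr => i _ do under eq_bigr => j _ do
    rewrite of_gaussD of_gaussM mulrDr mulrCA.
  under eq_bigr => i _ do rewrite big_split -mulr_sumr /=.
  by rewrite big_split -mulr_sumr prod0 //= mulr0 IHc addr0.
apply/matrixP => p q; rewrite [RHS]mxE.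
move: certificate_correct => /(all_belowP p)/(all_belowP q).
case: certificate_at => D cert /and3P[D0 /cert0 sum0 certE].
have value (i j : 'I_7) : of_gauss (certified_value cert i j) =
    if (p == i) && (q == j) then D%:~R else 0.
  have /eqP -> := all_belowP j (all_belowP i certE).
  rewrite -[p == i]val_eqE -[q == j]val_eqE.
  by case: ifP => _ //; rewrite -[RHS](rmorph_int (real_complex R)).
move: sum0; rewrite (bigD1 p) //= (bigD1 q) //= !big1; first last.
- by move=> j /negPf qj; rewrite value [q == j]eq_sym qj andbF mulr0.
- move=> i /negPf pi; rewrite big1 // => j _.
  by rewrite value [p == i]eq_sym pi mulr0.
rewrite value !eqxx !addr0 => /eqP; rewrite mulf_eq0 => /orP[/eqP //|].
by rewrite intr_eq0 (negPf D0).
Qed.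

Lemma kraus5_marginal k (a b : 'I_5) :
  \sum_(j < 7) of_gauss (gauss_product k j j a b) = 5 * (a == b)%:R.
Proof.
rewrite -(of_gauss_sum 7 (fun j => gauss_product k j j a b)).
have /allP/(_ k) := all_belowP b (all_belowP a gauss_marginals).
move=> /(_ _)/eqP -> //; last by case: k.
rewrite -[a == b]val_eqE; case: ifP => _; last by rewrite mulr0.
by rewrite mulr1 -[RHS](rmorph_nat (real_complex R)).
Qed.

Definition kraus5_scaled (j : 'I_7) : 'M[C]_5 := 5^-1 *: kraus5 j.

Lemma kraus_form_scaled H X :
  kraus_form kraus5_scaled H X = 25^-1 *: kraus_form kraus5 H X.
Proof.
rewrite scaler_sumr; apply: eq_bigr => i _.
rewrite scaler_sumr; apply: eq_bigr => j _.
rewrite adjmxZ -scalemxAl -scalemxAl -scalemxAr !scalerA; congr (_ *: _).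
by rewrite fmorphV rmorph_nat -mulrA -invfM -natrM mulrC.
Qed.

Lemma dual_form_scaled H X :
  dual_form kraus5_scaled H X = 25^-1 *: dual_form kraus5 H X.
Proof.
rewrite scaler_sumr; apply: eq_bigr => i _.
rewrite scaler_sumr; apply: eq_bigr => j _.
rewrite adjmxZ -scalemxAl -scalemxAl -scalemxAr !scalerA; congr (_ *: _).
by rewrite fmorphV rmorph_nat -mulrA -invfM -natrM mulrC.
Qed.

Lemma kraus5_scaled_independent : independent_products kraus5_scaled.
Proof.
have n25 : 25^-1 != 0 :> C by rewrite invr_eq0 pnatr_eq0.
have inj0 (A : 'M[C]_5) : 25^-1 *: A = 0 -> A = 0.
  by move=> /(canRL (scalerK n25)) ->; rewrite scaler0.
move=> H; rewrite kraus_form_scaled dual_form_scaled => /inj0 kH /inj0 dH.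
exact: (kraus5_independent kH dH).
Qed.

Lemma kraus5_scaled_unital :
  kraus_form kraus5_scaled 1%:M 1%:M = 5^-1 *: 1%:M /\
  dual_form kraus5_scaled 1%:M 1%:M = 5^-1 *: 1%:M.
Proof.
have n5 : 25^-1 * 5 = 5^-1 :> C.
  by rewrite (natrM _ 5 5) invfM -mulrA mulVf ?mulr1 // pnatr_eq0.
rewrite kraus_form_scaled dual_form_scaled kraus_form1 dual_form1.
split; apply/matrixP => a b; rewrite !mxE -n5 -mulrA; congr (_ * _).
  rewrite -(kraus5_marginal true) summxE; apply: eq_bigr => j _.
  by rewrite mulmx1 kraus5_adjl.
rewrite -(kraus5_marginal false) summxE; apply: eq_bigr => j _.
by rewrite mulmx1 kraus5_adjr.
Qed.

End Example.

Theorem corollary4p5 (R : realType) :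
  MR (5^-1 *: 1%:M : 'M[R[i]]_5) (5^-1 *: 1%:M : 'M[R[i]]_5) = 7%:E
  /\ (7 : int) = Num.floor (Num.sqrt (5 ^+ 2 + 5 ^+ 2 - 1 : R)).
Proof.
split; last first.
  have -> : 5 ^+ 2 + 5 ^+ 2 - 1 = 7 ^+ 2 :> R by lra.
  by rewrite sqrtr_sqr ger0_norm ?ler0n // (@intrKfloor R 7).
rewrite /MR; apply/eqP; rewrite eq_le; apply/andP; split.
  apply: ge_ereal_sup => _ [Phi ext <-]; rewrite lee_fin ler_nat.
  (* The squared rank is at most 49 < 64, so the rank is below 8. *)
  rewrite -ltnS -ltn_sqr.
  by apply: leq_ltn_trans (choi_rank_extreme_le _ ext) _.
have [Phi PhiE] := kraus_form_hom (@kraus5_scaled R) 1%:M.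
have PhiS X : Phi X = \sum_j (kraus5_scaled R j)^t* *m X *m kraus5_scaled R j.
  by rewrite PhiE kraus_form1.
have [k1 d1] := kraus5_scaled_unital R.
(* The explicit map attains the bound: independence gives both its extremality and its rank 7. *)
apply: ereal_sup_ubound; exists Phi.
  apply: (extreme_of_independent PhiS (@kraus5_scaled_independent R)).
  split; first by exists 7, (@kraus5_scaled R).
    by rewrite PhiE; exact: k1.
  by rewrite (dual_map_form PhiE) adjmx1.
by rewrite (choi_rank_independent PhiS (@kraus5_scaled_independent R)).
Qed.
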